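(* Let $\mathcal{R}\subseteq\mathbb{C}$ be the set of all complex numbers $z$ for which there exist a finite connected graph $G$ (multiple edges allowed, no loops) and two distinct vertices $s,t$ of $G$ such that $z$ is a root of the two-terminal reliability polynomial $\mathrm{Rel}_{s,t}(G;p)$. Then the closure $\overline{\mathcal{R}}$ in $\mathbb{C}$ contains both closed unit disks $\{z\in\mathbb{C}:|z|\le 1\}$ and $\{z\in\mathbb{C}:|z-1|\le 1\}$.
   Context: Graphs are finite, undirected and connected, may have multiple edges, and have no loops. Let $G$ be a graph with edge set $E(G)$, $m=|E(G)|$, and let $s,t$ be two distinct vertices of $G$ (the terminals). The two-terminal reliability of $(G,s,t)$, denoted $\mathrm{Rel}_{s,t}(G;p)$, is the probability that the spanning subgraph of operational edges contains an $s$-$t$ path, where each edge is independently operational with probability $p\in[0,1]$ and vertices are always operational. Explicitly, it is the polynomial $$\mathrm{Rel}_{s,t}(G;p)=\sum_{S\in\mathcal{S}_G}p^{|S|}(1-p)^{m-|S|},$$ where $\mathcal{S}_G$ is the collection of subsets $S\subseteq E(G)$ such that the spanning subgraph of $G$ with edge set $S$ contains an $s$-$t$ path. This polynomial is regarded as a polynomial in a complex variable $p$, and its complex roots are called two-terminal roots. *)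

(* Defs.v *)
From HB Require Import structures.
From mathcomp Require Import all_boot all_order all_algebra.
From mathcomp Require Import all_classical all_reals all_analysis.
From mathcomp Require Import complex.
Set Implicit Arguments.
Unset Strict Implicit.
Unset Printing Implicit Defensive.
Import Order.TTheory GRing.Theory Num.Theory.
Import numFieldNormedType.Exports.
Local Open Scope ring_scope.

(* Finite undirected loopless multigraphs: each edge has an unordered pair of
   distinct endpoints, and distinct edges may have the same endpoints. *)
Record multigraph := Multigraph {
  vertex : finType;
  edge : finType;
  endpoints : edge -> {set vertex};
  card_endpoints : forall e, #|endpoints e| = 2%N
}.

Definition adjacent (G : multigraph) (S : {set edge G}) : rel (vertex G) :=
  fun u v => [exists e in S, endpoints e == [set u; v]%SET].

Definition connected_graph (G : multigraph) : Prop :=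
  forall u v : vertex G, connect (adjacent [set: edge G]%SET) u v.

(* The condition [connect (adjacent S) s t] says that the spanning subgraph of G
   with edge set S contains an s-t path. *)
Definition reliability_poly (A : comNzRingType) (G : multigraph)
    (s t : vertex G) : {poly A} :=
  \sum_(S : {set edge G} | connect (adjacent S) s t)
    'X ^+ #|S| * (1 - 'X) ^+ (#|edge G| - #|S|).

Local Open Scope complex_scope.

Definition two_terminal_roots (R : realType) : set R[i] :=
  [set z | exists (G : multigraph) (s t : vertex G),
     [/\ connected_graph G, s != t & root (reliability_poly R[i] s t) z]]%classic.
Arguments two_terminal_roots R : clear implicits.

(* Main.v *)
Require Import Defs.
From mathcomp Require Import all_boot all_order all_algebra.
From mathcomp Require Import all_classical all_reals all_analysis.
From mathcomp Require Import complex ring.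
Set Implicit Arguments.
Unset Strict Implicit.
Unset Printing Implicit Defensive.
Import Order.TTheory GRing.Theory Num.Theory.
Import numFieldNormedType.Exports.
Local Open Scope classical_set_scope.
Local Open Scope complex_scope.
Local Open Scope ring_scope.

(** The theta graph with N parallel paths of length L, in which every edge is
    replaced by k parallel edges, has reliability
    [1 - (1 - (1 - (1 - z) ^ k) ^ L) ^ N] between its branch vertices
    ([reliability_theta]): blocking the terminals means breaking each of the
    N paths independently, a path works when its L bundles all work, and a
    bundle fails with probability [(1 - z) ^ k]. Two choices of the parameters
    give the two disks, all exponents being powers of 2.

    - With k = 1 and N = 2 ^ n.+1, z is a root as soon as
      [(1 - z ^ L) ^ (2 ^ n) = -1], which makes [1 - z ^ L] an N-th root of
      unity.
    - With N = 2 and L = 2 ^ n, and with u = 1 - z, z is a root as soon as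
      [(1 - u ^ k) ^ (2 ^ n) = 2].

    So both halves follow from one density statement
    ([dense_iterated_roots]): for x = -1 and for x = 2, the solutions u of
    [(1 - u ^ (2 ^ m)) ^ (2 ^ n) = x], for all m and n, accumulate at every
    point z of the closed unit disk. To find a solution near z with
    0 < |z| <= 1, fix m large and put d = |z| ^ (2 ^ m). Taking square roots
    with nonnegative real part repeatedly, starting from x, moves the points
    towards 1. Since [y ^ 2 - 1 = (y + 1) (y - 1)], each step divides the
    distance to 1 by a factor between the square root of 2 and 3, so some
    iterate y is at distance between d and 3 d from 1
    ([iterated_sqrt_at_distance]). The number [v = (1 - y) / z ^ (2 ^ m)] then
    has modulus between 1 and 3, and the same contraction, applied m times to
    v, yields a 2 ^ m-th root t of v within [4 / sqrt (2 ^ m)] of 1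
    ([iterated_sqrt_near1]). Hence u = z t satisfies [1 - u ^ (2 ^ m) = y] and
    is close to z. *)

(** * Iterated square roots and the density of roots *)

Lemma exists_sqrt_Re_ge0 (C : numClosedFieldType) (x : C) :
  exists2 y : C, y ^+ 2 = x & 0 <= 'Re y.
Proof.
have [Re_ge0|Re_lt0] := real_ge0P (Creal_Re (sqrtC x)).
  by exists (sqrtC x); rewrite ?sqrtCK.
exists (- sqrtC x); first by rewrite sqrrN sqrtCK.
by rewrite raddfN oppr_ge0 ltW.
Qed.

Lemma sqr_norm_add1_ge2 (C : numClosedFieldType) (y : C) :
  1 <= `|y| -> 0 <= 'Re y -> 2 <= `|y + 1| ^+ 2.
Proof.
move=> y_ge1 Re_ge0; rewrite normC2_Re_Im !raddfD /=.
have [-> ->] : 'Re (1 : C) = 1 /\ 'Im (1 : C) = 0.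
  by split; [apply/Creal_ReP | apply/Creal_ImP]; rewrite ?rpred1.
have -> : ('Re y + 1) ^+ 2 + ('Im y + 0) ^+ 2
          = `|y| ^+ 2 + 1 + 'Re y *+ 2 by rewrite normC2_Re_Im; ring.
have -> : (2 : C) = 1 + 1 + 0 by ring.
by rewrite !lerD ?mulrn_wge0 ?expr_ge1.
Qed.

Lemma norm_root_ge1 (C : numClosedFieldType) (n : nat) (y : C) :
  (0 < n)%N -> 1 <= `|y ^+ n| -> 1 <= `|y|.
Proof. by move=> n_gt0; rewrite normrX expr_ge1. Qed.

(** The factor [y + 1] of [y ^ 2 - 1] is bounded away from 0 because [y] lies
    outside the open unit disk, in the right half-plane. *)
Lemma sqrt_dist1 (C : numClosedFieldType) (y : C) :
  1 <= `|y| -> 0 <= 'Re y -> 2 * `|y - 1| ^+ 2 <= `|y ^+ 2 - 1| ^+ 2.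
Proof.
move=> y_ge1 Re_ge0.
have -> : y ^+ 2 - 1 = (y + 1) * (y - 1) by ring.
by rewrite normrM exprMn ler_wpM2r ?exprn_ge0 // sqr_norm_add1_ge2.
Qed.

(** Halving the squared distance to 1 at each square root locates a root of
    high order near 1 without polar coordinates. *)
Lemma iterated_sqrt_near1 (C : numClosedFieldType) (n : nat) (x : C) :
  1 <= `|x| ->
  exists2 y : C, y ^+ (2 ^ n) = x & 2 ^+ n * `|y - 1| ^+ 2 <= `|x - 1| ^+ 2.
Proof.
elim: n x => [|n IHn] x x_ge1.
  by exists x; rewrite ?expr1 // expr0 mul1r.
have [y y2x Re_ge0] := exists_sqrt_Re_ge0 x.
have y_ge1 : 1 <= `|y| by apply: (@norm_root_ge1 _ 2) => //; rewrite y2x.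
have [t tny dist_t] := IHn y y_ge1.
exists t; first by rewrite expnS mulnC exprM tny.
have := sqrt_dist1 y_ge1 Re_ge0; rewrite y2x; apply: le_trans.
by rewrite exprS -mulrA ler_wpM2l.
Qed.

(** A step that starts farther than [3 * d] from 1 ends at distance at least
    [d], because it divides the distance by [|y + 1| <= 3]; and the distances
    tend to 0. The last hypothesis bounds the number of steps. *)
Lemma iterated_sqrt_at_distance (C : numClosedFieldType) (n : nat) (d x : C) :
    0 < d -> 1 <= `|x| <= 2 -> d <= `|x - 1| ->
    `|x - 1| ^+ 2 <= 2 ^+ n * d ^+ 2 ->
  exists m y, y ^+ (2 ^ m) = x /\ d <= `|y - 1| <= 3 * d.
Proof.
move=> d_gt0; elim: n x => [|n IHn] x /andP[x_ge1 x_le2] dx dist_x;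
  have [x_le3d | x_gt3d] := real_leP (normr_real (x - 1))
    (realM (realn C 3) (gtr0_real d_gt0)).
all: try by exists 0%N, x; rewrite expr1 dx x_le3d.
- move: dist_x; rewrite mul1r ler_sqr ?nnegrE ?(ltW d_gt0) // => dist_x.
  exists 0%N, x; rewrite expr1 dx; split=> //; apply: le_trans dist_x _.
  by rewrite ler_peMl ?ltW // -[3]/3%:R ltr1n.
have [y y2x Re_ge0] := exists_sqrt_Re_ge0 x.
have y_ge1 : 1 <= `|y| by apply: (@norm_root_ge1 _ 2) => //; rewrite y2x.
have y_le2 : `|y| <= 2.
  rewrite -(@ler_pXn2r _ 2) ?nnegrE // -normrX y2x (le_trans x_le2) //.
  by rewrite -natrX ler_nat.
have [] := IHn y; first by rewrite y_ge1.
- have y1_le3 : `|y + 1| <= 3.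
    by rewrite (le_trans (ler_normD _ _)) // normr1 -[3]/(2 + 1)%:R natrD lerD.
  have : 3 * d <= 3 * `|y - 1|.
    apply: le_trans (ltW x_gt3d) _; rewrite -y2x.
    have -> : y ^+ 2 - 1 = (y + 1) * (y - 1) by ring.
    by rewrite normrM ler_wpM2r.
  by rewrite ler_pM2l ?ltr0n.
- have := le_trans (sqrt_dist1 y_ge1 Re_ge0) _; rewrite y2x => /(_ _ dist_x).
  by rewrite (exprS 2) -mulrA ler_pM2l ?ltr0n.
move=> m [t [tmy dist_t]]; exists m.+1, t; split=> //.
by rewrite expnS mulnC exprM tmy.
Qed.

(** The order on [R[i]] is partial, but a nonnegative element is real, so the
    archimedean property of [R] applies to it. *)
Lemma exists_expr2_gt (R : realType) (x : R[i]) :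
  0 <= x -> exists n, x < 2 ^+ n.
Proof.
case: x => a b; rewrite lecE /= => /andP[/eqP-> a_ge0].
exists (Num.bound a); have := upper_nthrootP (leqnn (Num.bound a)).
by rewrite -(@ltcR R) rmorphXn /= rmorph_nat.
Qed.

Lemma dense_iterated_roots_punctured (R : realType) (x z e : R[i]) :
    1 <= `|x| <= 2 -> 1 <= `|x - 1| -> 0 < `|z| <= 1 -> 0 < e ->
  exists m n u, (1 - u ^+ (2 ^ m)) ^+ (2 ^ n) = x /\ `|z - u| < e.
Proof.
move=> x_bnd x1_ge1 /andP[z_gt0 z_le1] e_gt0.
(* 4 bounds |v - 1| for the v introduced further on, since |v| <= 3. *)
have [m lt_m] : exists m, 4 ^+ 2 / e ^+ 2 < 2 ^+ m :> R[i].
  by apply: exists_expr2_gt; rewrite divr_ge0 ?exprn_ge0 ?ler0n // ltW.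
pose d := `|z| ^+ (2 ^ m).
have d_gt0 : 0 < d by rewrite exprn_gt0.
have d_le1 : d <= 1 by rewrite exprn_ile1.
have [k lt_k] : exists k, `|x - 1| ^+ 2 / d ^+ 2 < 2 ^+ k.
  by apply: exists_expr2_gt; rewrite divr_ge0 ?exprn_ge0 // ltW.
have [||n [y [ynx /andP[y_ge y_le]]]] :=
  @iterated_sqrt_at_distance _ k d x d_gt0 x_bnd.
- exact: le_trans x1_ge1.
- by rewrite -ler_pdivrMr ?exprn_gt0 // ltW.
pose v := (1 - y) / z ^+ (2 ^ m).
have norm_v : `|v| = `|y - 1| / d by rewrite normrM normfV normrX distrC.
have v_ge1 : 1 <= `|v| by rewrite norm_v ler_pdivlMr // mul1r.
have v_le3 : `|v| <= 3 by rewrite norm_v ler_pdivrMr.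
have [t tmv dist_t] := iterated_sqrt_near1 m v_ge1.
have z_neq0 : z != 0 by rewrite -normr_gt0.
exists m, n, (z * t); split.
  by rewrite exprMn tmv mulrC divfK ?expf_neq0 // subKr.
have -> : z - z * t = z * (1 - t) by ring.
rewrite normrM (le_lt_trans (ler_piMl _ z_le1)) // distrC.
rewrite -(@ltr_pXn2r _ 2) ?nnegrE ?(ltW e_gt0) //
  -(@ltr_pM2l _ (2 ^+ m)) ?exprn_gt0 ?ltr0n //.
apply: le_lt_trans dist_t _; rewrite -ltr_pdivrMr ?exprn_gt0 //.
apply: le_lt_trans lt_m; rewrite ler_pM2r ?invr_gt0 ?exprn_gt0 //.
rewrite ler_pXn2r ?nnegrE ?ler0n // (le_trans (ler_normB _ _)) //.
by rewrite normr1 -[4]/(3 + 1)%:R natrD lerD.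
Qed.

Lemma dense_iterated_roots (R : realType) (x z e : R[i]) :
    1 <= `|x| <= 2 -> 1 <= `|x - 1| -> `|z| <= 1 -> 0 < e ->
  exists m n u, (1 - u ^+ (2 ^ m)) ^+ (2 ^ n) = x /\ `|z - u| < e.
Proof.
move=> x_bnd x1_ge1 z_le1 e_gt0.
(* For z = 0 the modulus d would vanish, so a nearby point e / (1 + e) of
   the punctured disk is approximated instead. *)
have [z0|z_neq0] := eqVneq z 0; last first.
  by apply: dense_iterated_roots_punctured; rewrite ?normr_gt0 ?z_neq0.
have e1_gt0 : 0 < 1 + e by rewrite addr_gt0.
pose c := e / (1 + e).
have c_gt0 : 0 < c by rewrite divr_gt0.
have norm_c : `|c| = c by rewrite gtr0_norm.
have c_le1 : c <= 1 by rewrite ler_pdivrMr // mul1r lerDr.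
have c_lt : 0 < e - c.
  by rewrite subr_gt0 ltr_pdivrMr // mulrDr mulr1 ltrDl mulr_gt0.
have [|m [n [u [root_u dist_u]]]] :=
  @dense_iterated_roots_punctured _ x c (e - c) x_bnd x1_ge1 _ c_lt.
  by rewrite norm_c c_gt0.
exists m, n, u; split=> //; rewrite z0 sub0r normrN.
have -> : u = c - (c - u) by ring.
by rewrite (le_lt_trans (ler_normB _ _)) // norm_c addrC -ltrBrDr.
Qed.

(** * Reliability as a sum of weights over independent edges *)

(** For [x] in [0, 1] this is the probability of the event [Q] when each
    element of [T] is selected independently with probability [x]; [x] is left
    arbitrary because the reliability is evaluated at complex points. *)
Definition event_prob (A : comNzRingType) (T : finType) (x : A)
    (Q : pred {set T}) : A :=
  \sum_(S | Q S) \prod_e (if e \in S then x else 1 - x).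

Lemma eq_event_prob (A : comNzRingType) (T : finType) (x : A)
    (Q Q' : pred {set T}) :
  Q =1 Q' -> event_prob x Q = event_prob x Q'.
Proof. by move=> eqQ; apply: eq_bigl. Qed.

Definition slice (I J : finType) (S : {set I * J}) (i : I) : {set J} :=
  [set b | (i, b) \in S]%SET.

Lemma horner_reliability (A : comNzRingType) (G : multigraph)
    (s t : vertex G) (x : A) :
  (reliability_poly A s t).[x] =
  event_prob x (fun S => connect (Defs.adjacent S) s t).
Proof.
rewrite /reliability_poly horner_sum; apply: eq_bigr => S _.
rewrite !hornerE (bigID (mem S)) /=; congr (_ * _).
  rewrite (eq_bigr (fun=> x)) => [|e ->] //.
  by rewrite prodr_const.
rewrite (eq_bigr (fun=> 1 - x)) => [|e /negPf->] //.
have -> : (#|edge G| - #|S| = #|(~: S)%SET|)%N.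
  by rewrite -(finset.cardsC S) addKn.
rewrite (eq_bigl (mem (~: S)%SET)) => [|e]; last by rewrite !inE.
by rewrite prodr_const.
Qed.

Lemma event_prob_predT (A : comNzRingType) (T : finType) (x : A) :
  event_prob x (predT : pred {set T}) = 1.
Proof.
have <- : \prod_(e : T) (x + (1 - x)) = 1 :> A.
  by rewrite big1 // => e _; rewrite subrKC.
by rewrite bigA_distr.
Qed.

Lemma event_probC (A : comNzRingType) (T : finType) (x : A)
    (Q : pred {set T}) :
  event_prob x (fun S => ~~ Q S) = 1 - event_prob x Q.
Proof.
apply/eqP; rewrite eq_sym subr_eq -(event_prob_predT T x) addrC.
by rewrite /event_prob [X in X == _](bigID Q).
Qed.

Lemma event_prob_set0 (A : comNzRingType) (T : finType) (x : A) :
  event_prob x (pred1 (finset.set0 : {set T})) = (1 - x) ^+ #|T|.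
Proof.
rewrite /event_prob big_pred1_eq (eq_bigr (fun=> 1 - x)) ?prodr_const //.
by move=> e _; rewrite finset.in_set0.
Qed.

(** Independence: the slices of a subset of [I * J] are arbitrary subsets of
    [J], and the weight of the subset is the product of theirs. *)
Lemma event_prob_forall (A : comNzRingType) (I J : finType) (x : A)
    (Q : I -> pred {set J}) :
  event_prob x (fun S : {set I * J} => [forall i, Q i (slice S i)]) =
  \prod_i event_prob x (Q i).
Proof.
rewrite /event_prob bigA_distr_big_dep.
pose graph (f : {ffun I -> {set J}}) : {set I * J} :=
  [set e | e.2 \in f e.1]%SET.
have sliceK (f : {ffun I -> {set J}}) i : slice (graph f) i = f i.
  by apply/finset.setP => b; rewrite !inE.
rewrite (reindex graph) /=; last first.
  exists (fun S => [ffun i => slice S i]) => [f _|S _].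
    by apply/ffunP => i; rewrite ffunE sliceK.
  by apply/finset.setP => -[i b]; rewrite !inE ffunE inE.
apply: eq_big => [f|f _].
  by apply: eq_forallb => i; rewrite sliceK.
rewrite pair_bigA /=; apply: eq_bigr => -[i b] _ /=.
by rewrite inE.
Qed.

(** * Theta graphs with bundled edges *)

Lemma adjacent_sym (G : multigraph) (S : {set edge G}) :
  symmetric (Defs.adjacent S).
Proof. by move=> u v; rewrite /Defs.adjacent finset.setUC. Qed.

Section ThetaGraph.
Variables N l k : nat.

(** Each path has [l.+1] bundles, so [l] internal vertices; the left summand
    holds the two terminals. *)
Definition theta_vertex : finType := (bool + 'I_N * 'I_l)%type.

(** The edge [(i, (j, c))] is the [c]-th copy of the [j]-th edge of path [i];
    the nesting makes bundles and paths slices of the edge set. *)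
Definition theta_edge : finType := ('I_N * ('I_l.+1 * 'I_k))%type.

(** All paths share their ends: position 0 is the source, position [a.+1] the
    internal vertex [a < l], and any position beyond [l] the target. *)
Definition theta_node (i : 'I_N) (j : nat) : theta_vertex :=
  if j is j'.+1 then
    if insub j' is Some a then inr (i, a) else inl true
  else inl false.

Definition theta_endpoints (e : theta_edge) : {set theta_vertex} :=
  [set theta_node e.1 e.2.1; theta_node e.1 e.2.1.+1]%SET.

Lemma card_theta_endpoints e : #|theta_endpoints e| = 2%N.
Proof.
rewrite cards2; case: e => i [[j lt_j] c] /=.
rewrite /theta_node; case: j lt_j => [|j] lt_j /=.
  by case: insub.
rewrite (insubT (fun j => j < l)%N lt_j) /=; case: insubP => //= a _ aE.
by rewrite eqE /= xpair_eqE eqxx -val_eqE /= aE neq_ltn ltnSn.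
Qed.

Definition theta : multigraph := Multigraph card_theta_endpoints.
Definition theta_s : vertex theta := inl false.
Definition theta_t : vertex theta := inl true.

Lemma theta_node_last (i : 'I_N) : theta_node i l.+1 = theta_t.
Proof. by rewrite /theta_node insubF ?ltnn. Qed.

Lemma theta_node_internal (i : 'I_N) (a : 'I_l) :
  theta_node i a.+1 = inr (i, a).
Proof. by rewrite /theta_node valK. Qed.

Lemma connect_theta_prefix (S : {set edge theta}) (i : 'I_N) (n : nat) :
    (n <= l.+1)%N ->
    (forall j : 'I_l.+1, (j < n)%N -> slice (slice S i) j != finset.set0) ->
  connect (Defs.adjacent S) theta_s (theta_node i n).
Proof.
elim: n => [|n IHn] le_n open_n; first exact: connect0.
apply: connect_trans (IHn (ltnW le_n) _) _ => [j lt_j|].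
  exact: open_n (ltnW lt_j).
have /set0Pn[c] := open_n (Ordinal le_n) (leqnn _).
rewrite !inE => Sc; apply/connect1/existsP.
by exists (i, (Ordinal le_n, c)); rewrite Sc /= eqxx.
Qed.

(** The vertices at position at most [f i] on path [i] form a cut that
    separates the terminals and is crossed only by the empty bundles. *)
Lemma theta_cut (S : {set edge theta}) (f : 'I_N -> 'I_l.+1) :
  (forall i, slice (slice S i) (f i) = finset.set0) ->
  ~~ connect (Defs.adjacent S) theta_s theta_t.
Proof.
move=> closed_f.
pose A := [pred v : vertex theta |
  match v with inl b => ~~ b | inr (i, a) => (a.+1 <= f i)%N end].
have AE (i : 'I_N) (j : nat) : (j <= l.+1)%N ->
    (theta_node i j \in A) = (j <= f i)%N.
  case: j => // j; rewrite ltnS leq_eqVlt => /predU1P[->|lt_jl].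
    by rewrite theta_node_last leqNgt ltn_ord.
  by rewrite -[j]/(nat_of_ord (Ordinal lt_jl)) theta_node_internal.
have closedA : fingraph.closed (Defs.adjacent S) A.
  move=> u v /existsP[[i [j c]] /andP[Sc /eqP/= uvE]].
  (* A bundle of S leaves the cut only at j = f i, where it is empty. *)
  have node_eq : (theta_node i j \in A) = (theta_node i j.+1 \in A).
    rewrite !AE //; last exact: ltnW.
    rewrite [RHS]ltn_neqAle; case: eqP => //= /val_inj jE.
    by have /finset.setP/(_ c) := closed_f i; rewrite !inE -jE Sc.
  have mem_ends w : w \in [set u; v]%SET ->
      (w \in A) = (theta_node i j \in A).
    by rewrite -uvE => /set2P[->|->].
  by rewrite !mem_ends ?set21 ?set22.
by apply/negP => /(closed_connect closedA); rewrite !inE.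
Qed.

Lemma connect_thetaE (S : {set edge theta}) :
  connect (Defs.adjacent S) theta_s theta_t =
  ~~ [forall i, ~~ [forall j, slice (slice S i) j != finset.set0]].
Proof.
apply/idP/idP; last first.
  rewrite negb_forall => /existsP[i /negPn/forallP open_i].
  by rewrite -(theta_node_last i); apply: connect_theta_prefix.
apply: contraTN => /forallP closed_S.
have /fin_all_exists[f closed_f] i :
    exists j, slice (slice S i) j = finset.set0.
  have := closed_S i; rewrite negb_forall => /existsP[j].
  by rewrite negbK => /eqP; exists j.
exact: theta_cut closed_f.
Qed.

Lemma theta_connected : (0 < N)%N -> (0 < k)%N -> connected_graph theta.
Proof.
move=> N_gt0 k_gt0.
have s_node (i : 'I_N) (n : nat) : (n <= l.+1)%N ->
    connect (Defs.adjacent [set: edge theta]%SET) theta_s (theta_node i n).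
  move=> le_n; apply: connect_theta_prefix => // j _.
  by apply/set0Pn; exists (Ordinal k_gt0); rewrite !inE.
have s_connect v : connect (Defs.adjacent [set: edge theta]%SET) theta_s v.
  case: v => [[]|[i a]]; last 1 first.
  - by rewrite -theta_node_internal; apply: s_node; rewrite ltnS ltnW.
  - by rewrite -[inl true](theta_node_last (Ordinal N_gt0)); apply: s_node.
  - exact: connect0.
move=> u v; apply: connect_trans (s_connect v).
by rewrite (sym_connect_sym (adjacent_sym _)).
Qed.

Lemma reliability_theta (A : comNzRingType) (x : A) :
  (reliability_poly A theta_s theta_t).[x] =
  1 - (1 - (1 - (1 - x) ^+ k) ^+ l.+1) ^+ N.
Proof.
rewrite horner_reliability.
rewrite (eq_event_prob x connect_thetaE) event_probC.
rewrite (event_prob_forall x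
  (fun _ B => ~~ [forall j, slice B j != finset.set0])).
rewrite prodr_const card_ord; congr (1 - _ ^+ _).
rewrite (event_probC x (fun B => [forall j, slice B j != finset.set0])).
rewrite (event_prob_forall x (fun _ B => B != finset.set0)) prodr_const card_ord.
congr (1 - _ ^+ _).
by rewrite (event_probC x (pred1 finset.set0)) event_prob_set0 card_ord.
Qed.

End ThetaGraph.

Lemma theta_root_mem (R : realType) (N L k : nat) (z : R[i]) :
    (0 < N)%N -> (0 < L)%N -> (0 < k)%N ->
    (1 - (1 - (1 - z) ^+ k) ^+ L) ^+ N = 1 ->
  two_terminal_roots R z.
Proof.
case: L => // l N_gt0 _ k_gt0 zN.
exists (theta N l k), (theta_s N l k), (theta_t N l k); split=> //.
  exact: theta_connected.
by rewrite rootE reliability_theta zN subrr.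
Qed.

(** * Density in the two disks *)

Lemma closure_two_terminal_roots (R : realType) (z : R[i]) :
  (forall e : R[i], 0 < e ->
     exists2 u : R[i], two_terminal_roots R u & `|z - u| < e) ->
  closure (two_terminal_roots R : set R[i]^o) z.
Proof.
move=> near_z B /nbhs_ballP[e e_gt0 ballB].
have [u root_u dist_u] := near_z e e_gt0.
by exists u; split=> //; apply: ballB.
Qed.

Theorem theorem3p1 (R : realType) :
  [set z : R[i] | `|z| <= 1] `<=` closure (two_terminal_roots R : set R[i]^o) /\
  [set z : R[i] | `|z - 1| <= 1] `<=` closure (two_terminal_roots R : set R[i]^o).
Proof.
split=> z /= z_le1; apply: closure_two_terminal_roots => e e_gt0.
- have [||m [n [u [root_u dist_u]]]] :=
    @dense_iterated_roots R (- 1) z e _ _ z_le1 e_gt0.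
  + by rewrite normrN1 lexx ler1n.
  + have -> : (- 1 : R[i]) - 1 = - 2 by ring.
    by rewrite normrN normr_nat ler1n.
  exists u => //; apply: (@theta_root_mem R (2 ^ n.+1) (2 ^ m) 1).
  + by rewrite expn_gt0.
  + by rewrite expn_gt0.
  + by [].
  by rewrite expr1 subKr expnS mulnC exprM root_u sqrrN expr1n.
have [|||m [n [u [root_u dist_u]]]] :=
  @dense_iterated_roots R 2 (1 - z) e _ _ _ e_gt0.
- by rewrite normr_nat lexx ler1n.
- have -> : (2 : R[i]) - 1 = 1 by ring.
  by rewrite normr1.
- by rewrite distrC.
exists (1 - u); last first.
  by rewrite distrC addrAC.
apply: (@theta_root_mem R 2 (2 ^ n) (2 ^ m)); rewrite ?expn_gt0 //.
rewrite subKr root_u; ring.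
Qed.
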